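(* For every dataset $\{(s_i,y_i,w_i)\}_{i=1}^N$ with $N\ge1$, $s_i\in\mathbb{R}$, $y_i\in\{0,1\}$, $w_i>0$, with associated duplicated dataset $\Omega$, $$\mathrm{LxCIM}\bigl(\{(s_i,y_i,w_i)\}_{i=1}^N\bigr)=\mathrm{ACC}^2+2H,$$ where $\mathrm{ACC}$ is the weighted accuracy of the original dataset and $H=\int_0^{1-\mathrm{ACC}}\mathrm{TPR}\;d\,\mathrm{FPR}$ is the area under the ROC curve of $\Omega$ over the range $0\le \mathrm{FPR}\le 1-\mathrm{ACC}$.
   Context: Decision function: $g:\mathbb{R}\to\mathbb{R}$ is a fixed function with a point $s^*\in\mathbb{R}$ such that $g$ is strictly decreasing for $s<s^*$, strictly increasing for $s>s^*$, attains its global minimum at $s^*$, satisfies $g^{-1}(\{g(s^* )\})=\{s^*\}$, and for every $s\ne s^*$ satisfies $g^{-1}(\{g(s)\})=\{s,s'\}$ for exactly one $s'\neq s$ (which then lies on the other side of $s^*$). A dataset is an indexed family of triples $(s_i,y_i,w_i)$ (score, true label in $\{0,1\}$, positive weight). Prediction function: $u(s)=1$ if $s>s^*$, and $u(s)=0$ otherwise. Put $W=\sum_{k=1}^N w_k$ and $\mathrm{ACC}=\frac1W\sum_{i=1}^N w_i\,\mathbb{I}[u(s_i)=y_i]$. Let $\pi$ be a permutation of $\{1,\dots,N\}$ with $g(s_{\pi(1)})\ge\dots\ge g(s_{\pi(N)})$ (ties broken in any fixed way). LxCIM: for $t\in(0,W]$ let $j(t)=\pi(k)$, where $k$ is the unique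 index with $\sum_{l=1}^{k-1}w_{\pi(l)}<t\le\sum_{l=1}^{k}w_{\pi(l)}$. Define $$G(t)=\frac1W\int_0^t \mathbb{I}\bigl[u(s_{j(r)})=y_{j(r)}\bigr]\,dr,\qquad \mathrm{LxCIM}=\frac{2}{W}\int_0^W G(t)\,dt .$$ Duplicated dataset: let $A(s^*,y,w)=(s^*,y,w)$, and for $s\ne s^*$ let $A(s,y,w)=(s',1-y,w)$, where $\{s,s'\}=g^{-1}(\{g(s)\})$, $s'\ne s$. The duplicated dataset $\Omega$ is the family of $2N$ triples (counted with multiplicity) consisting of all $(s_i,y_i,w_i)$ and all $A(s_i,y_i,w_i)$, $i=1,\dots,N$. ROC curve of $\Omega$: list $\Omega$ in decreasing order of score as $p_1,\dots,p_N,q_N,\dots,q_1$, where $p_i,q_i$ are the two triples $(s_{\pi(i)},y_{\pi(i)},w_{\pi(i)})$ and $A(s_{\pi(i)},y_{\pi(i)},w_{\pi(i)})$: if $s_{\pi(i)}\neq s^*$, $p_i$ is the one with score $>s^*$ and $q_i$ the one with score $<s^*$; if $s_{\pi(i)}=s^*$, the two triples are equal and $p_i=q_i=(s^*,y_{\pi(i)},w_{\pi(i)})$. For $m=0,\dots,2N$, let $\mathrm{TPR}_m$ (resp. $\mathrm{FPR}_m$) be the total weight of the triples with label $1$ (resp. label $0$) among the first $m$ in this list, divided by the total weight of all triples in $\Omega$ with label $1$ (resp. label $0$). The ROC curve is the polygonal path joining the points $(\mathrm{FPR}_m,\mathrm{TPR}_m)$, $m=0,\dots,2N$, in order, going from $(0,0)$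 to $(1,1)$; each of its segments is horizontal or vertical.
   Formalization: Adds the assumption that no score s_i equals s*; without it the identity fails, e.g. g(s)=s², data (1,1,1),(0,1,1): LxCIM=3/4 but ACC²+2H=5/4. *)

(* Defs.v *)
From HB Require Import structures.
From mathcomp Require Import all_boot all_order all_fingroup all_algebra.
From mathcomp Require Import all_classical all_reals all_analysis.

Set Implicit Arguments.
Unset Strict Implicit.
Unset Printing Implicit Defensive.

Import Order.TTheory GRing.Theory Num.Theory.
Import numFieldNormedType.Exports.

Local Open Scope classical_set_scope.
Local Open Scope ring_scope.

Record triple (R : realType) := Triple {
  score : R;
  label : bool;
  weight : R
}.

Section Decision.
Variables (R : realType) (g : R -> R) (sstar : R).

Record decision_function : Prop := DecisionFunction {
  decision_decreasing : forall s t, s < t -> t < sstar -> g t < g s;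
  decision_increasing : forall s t, sstar < s -> s < t -> g s < g t;
  decision_min : forall s, g sstar <= g s;
  decision_fiber_min : g @^-1` [set g sstar] = [set sstar];
  decision_fiber : forall s, s <> sstar ->
    exists! s', s' <> s /\ g @^-1` [set g s] = [set s; s']
}.

Definition predict (s : R) : bool := sstar < s.

Definition correct (x : triple R) : bool := predict (score x) == label x.

Definition mirror (s : R) : R :=
  get [set s' | s' <> s /\ g @^-1` [set g s] = [set s; s']].

(* A triple at [sstar] is its own dual, so duplication counts its label twice.
   Without such triples, each label has total weight [total_weight] in
   [duplicated]. *)
Definition dual (x : triple R) : triple R :=
  if score x == sstar then x
  else Triple (mirror (score x)) (~~ label x) (weight x).

End Decision.

Section Measures.
Variables (R : realType) (g : R -> R) (sstar : R).
Variables (N : nat) (d : 'I_N -> triple R) (pi : {perm 'I_N}).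

Notation mu := (@lebesgue_measure R).

Definition total_weight : R := \sum_i weight (d i).

Definition accuracy : R :=
  (\sum_i weight (d i) * (correct sstar (d i))%:R) / total_weight.

Definition sorting : Prop :=
  forall i j : 'I_N, (i <= j)%N ->
    g (score (d (pi j))) <= g (score (d (pi i))).

Definition weight_before (k : 'I_N) : R :=
  \sum_(l < N | (l < k)%N) weight (d (pi l)).

(* j(t); it is [None] exactly when t lies outside ]0, W]. *)
Definition index_at (t : R) : option 'I_N :=
  omap pi [pick k : 'I_N |
    weight_before k < t <= weight_before k + weight (d (pi k))].

Definition correct_at (t : R) : bool :=
  if index_at t is Some i then correct sstar (d i) else false.

Definition gain (t : R) : R :=
  total_weight^-1 * \int[mu]_(r in `]0, t]) (correct_at r)%:R.

Definition LxCIM : R :=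
  2 / total_weight * \int[mu]_(t in `]0, total_weight]) gain t.

Definition duplicated : seq (triple R) :=
  [seq d i | i <- enum 'I_N] ++ [seq dual g sstar (d i) | i <- enum 'I_N].

(* p_i and q_i; when the score is [sstar], [dual] is the identity and the two
   triples coincide. *)
Definition upper (i : 'I_N) : triple R :=
  let x := d (pi i) in if sstar < score x then x else dual g sstar x.

Definition lower (i : 'I_N) : triple R :=
  let x := d (pi i) in if sstar < score x then dual g sstar x else x.

Definition roc_list : seq (triple R) :=
  [seq upper i | i <- enum 'I_N] ++ rev [seq lower i | i <- enum 'I_N].

Definition rate (b : bool) (m : nat) : R :=
  (\sum_(x <- take m roc_list | label x == b) weight x) /
  (\sum_(x <- duplicated | label x == b) weight x).

Definition TPR : nat -> R := rate true.

Definition FPR : nat -> R := rate false.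

Definition roc_curve : set (R * R) :=
  [set z | exists m : nat, exists a : R,
    [/\ (m < 2 * N)%N, 0 <= a <= 1,
        z.1 = (1 - a) * FPR m + a * FPR m.+1 &
        z.2 = (1 - a) * TPR m + a * TPR m.+1]].

(* The height of the curve above abscissa x. The choice of the supremum only
   matters at the finitely many abscissas of vertical segments. *)
Definition roc_height (x : R) : R := sup [set y | roc_curve (x, y)].

Definition partial_auc (c : R) : R := \int[mu]_(x in `[0, c]) roc_height x.

End Measures.

(* Main.v *)
Require Import Defs.
From HB Require Import structures.
From mathcomp Require Import all_boot all_order all_fingroup all_algebra.
From mathcomp Require Import all_classical all_reals all_analysis.
From mathcomp Require Import measurable_realfun ring lra.

(* The k-th item of the sorted dataset contributes to the first half of the ROC
   list a triple whose label is 1 exactly when the prediction is correct.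
   Hence for k <= N, W TPR_k and W FPR_k are the weights C_k and F_k of the
   correct and incorrect predictions among the first k items, so that
   TPR_N = ACC and FPR_N = 1 - ACC.  The gain is affine between the consecutive
   cumulated weights C_k + F_k, where it takes the values C_k / W; by the
   trapezoid rule W^2 LxCIM is the sum of (C_k + C_{k+1})(dC_k + dF_k), while
   W^2 H is the sum of C_k dF_k.  Since dC_k dF_k = 0, each term of the former
   is C_{k+1}^2 - C_k^2 + 2 C_k dF_k, and the squares telescope to C_N^2. *)

Import Order.TTheory GRing.Theory Num.Theory.
Import numFieldNormedType.Exports.

Local Open Scope classical_set_scope.
Local Open Scope ring_scope.

(** * Integrals over half-open intervals, assembled piece by piece *)

Section Integration.
Context {R : realType}.
Notation mu := (@lebesgue_measure R).
Implicit Types (f F h : R -> R) (x y z u v : R).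

(** Integrability is bundled with the value because additivity over adjacent intervals requires it;
    half-open intervals concatenate without overlap. *)
Definition integrates f x y v : Prop :=
  mu.-integrable `]x, y] (EFin \o f) /\ \int[mu]_(t in `]x, y]) f t = v.

Lemma integrates_nil f x : integrates f x x 0.
Proof.
rewrite /integrates set_itvoc0; split; first exact: integrable_set0.
exact: Rintegral_set0.
Qed.

Lemma integrates_cat f x y z u v : x <= y -> y <= z ->
  integrates f x y u -> integrates f y z v -> integrates f x z (u + v).
Proof.
move=> xy yz [fi <-] [gi <-].
have e : `]x, z]%classic = `]x, y] `|` `]y, z].
  by rewrite -itv_bndbnd_setU// bnd_simp.
have dis : [disjoint `]x, y]%classic & `]y, z]%classic].
  apply/disj_setPLR => t /=; rewrite !in_itv/= => /andP[_ ty].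
  by apply/negP; rewrite negb_and -leNgt ty.
have i : mu.-integrable `]x, z] (EFin \o f).
  have mf : measurable_fun (`]x, y] `|` `]y, z])%classic f.
    by apply/measurable_funU => //; split; apply/measurable_EFinP;
      [case/integrableP: fi|case/integrableP: gi].
  apply/integrableP; rewrite e; split; first exact/measurable_EFinP.
  rewrite ge0_integral_setU//=; last first.
    by apply/measurable_EFinP; exact: measurableT_comp.
  by rewrite lte_add_pinfty//; [case/integrableP: fi|case/integrableP: gi].
by split => //; rewrite e Rintegral_setU// -e.
Qed.

(** Agreement with [h] is asked on the open interval only: the endpoint [y] is a null set, and the
    height of the ROC curve will not be controlled at vertical segments. *)
Lemma integrates_primitive f h F x y : x <= y ->
  (forall t : R, is_derive t (1 : R) F (h t)) -> continuous h ->
  (forall t, x < t < y -> f t = h t) -> integrates f x y (F y - F x).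
Proof.
rewrite le_eqVlt => /predU1P[->|xy dF ch fh].
  by move=> _ _ _; rewrite subrr; exact: integrates_nil.
have hi : mu.-integrable `]x, y] (EFin \o h).
  have hc : mu.-integrable `[x, y] (EFin \o h).
    apply: continuous_compact_integrable; first exact: segment_compact.
    exact: continuous_subspaceT.
  by apply: integrableS hc => //; apply: subset_itvr; rewrite bnd_simp.
have hoo : mu.-integrable `]x, y[ (EFin \o h).
  by apply: integrableS hi => //; apply: subset_itvl; rewrite bnd_simp.
have foo : mu.-integrable `]x, y[ (EFin \o f).
  apply: eq_integrable hoo => // t; rewrite inE/= in_itv/= => xty.
  by rewrite fh.
have fi : mu.-integrable `]x, y] (EFin \o f).
  have mf : measurable_fun `]x, y] f.
    apply/measurable_fun_itv_bndo_bndcP.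
    by apply/measurable_EFinP; exact: (measurable_int mu foo).
  apply/(@negligible_integrable _ _ _ mu _ [set y]) => //.
  - exact/measurable_EFinP.
  - exact: lebesgue_measure_set1.
  - by rewrite setDitv1r.
split=> //.
transitivity (\int[mu]_(t in `]x, y]) h t).
  rewrite -!Rintegral_itv_bndo_bndc//; apply: eq_Rintegral => t.
  by rewrite inE/= in_itv/= => xty; rewrite fh.
rewrite Rintegral_itv_obnd_cbnd//.
rewrite /Rintegral (@continuous_FTC2 _ h F)//.
- exact: continuous_subspaceT.
- have cF t : {for t, continuous F}.
    exact/differentiable_continuous/derivable1_diffP.
  split.
  + by move=> t _; apply: ex_derive.
  + exact/cvg_at_right_filter/cF.
  + exact/cvg_at_left_filter/cF.
- by move=> t _; rewrite derive1E derive_val.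
Qed.

(** The value is the area of a trapezoid with left height [a] and slope [b]. *)
Lemma integrates_affine f a b x y : x <= y ->
  (forall t, x < t < y -> f t = a + b * (t - x)) ->
  integrates f x y (a * (y - x) + b * (y - x) ^+ 2 / 2).
Proof.
move=> xy fE.
pose F t := a * (t - x) + b / 2 * (t - x) ^+ 2.
have -> : a * (y - x) + b * (y - x) ^+ 2 / 2 = F y - F x.
  by rewrite /F; field.
apply: (@integrates_primitive _ (fun t => a + b * (t - x))) => //.
  move=> t; rewrite /F; apply: is_derive_eq.
  by rewrite /GRing.scale/=; field.
move=> t; apply: cvgD; first exact: cvg_cst.
apply: cvgM; first exact: cvg_cst.
by apply: cvgB; [exact: cvg_id|exact: cvg_cst].
Qed.

Lemma integrates_constant f a x y : x <= y ->
  (forall t, x < t < y -> f t = a) -> integrates f x y (a * (y - x)).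
Proof.
move=> xy fE.
have -> : a * (y - x) = a * (y - x) + 0 * (y - x) ^+ 2 / 2 by ring.
by apply: integrates_affine => // t /fE ->; ring.
Qed.

Lemma integrates_sum f (a v : nat -> R) (n : nat) :
  (forall k, (k < n)%N -> a k <= a k.+1) ->
  (forall k, (k < n)%N -> integrates f (a k) (a k.+1) (v k)) ->
  integrates f (a 0%N) (a n) (\sum_(0 <= k < n) v k).
Proof.
elim: n => [|n IH] ha hv.
  by rewrite big_nil; exact: integrates_nil.
have a0n m : (m <= n.+1)%N -> a 0%N <= a m.
  elim: m => // m IHm mn; exact: le_trans (IHm (ltnW mn)) (ha _ mn).
rewrite big_nat_recr//=.
apply: integrates_cat (a0n _ _) (ha _ _) _ (hv _ _) => //.
by apply: IH => k kn; [apply: ha|apply: hv]; exact: ltnW.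
Qed.

End Integration.

(** * Sums over initial segments of the index set *)

Section PartialSums.
Context {R : realType} {N : nat}.
Implicit Types (F : 'I_N -> R) (m n : nat).

(** The bound is a natural number rather than an ordinal, so that [m = N] is allowed and sums can
    telescope; [weight_before] is an instance. *)
Definition partial_sum F m : R := \sum_(i < N | (i < m)%N) F i.

Lemma partial_sum0 F : partial_sum F 0 = 0.
Proof. by rewrite /partial_sum big_pred0. Qed.

Lemma partial_sum_full F : partial_sum F N = \sum_i F i.
Proof. by apply: eq_bigl => i; rewrite ltn_ord. Qed.

Lemma partial_sumS F (k : 'I_N) : partial_sum F k.+1 = partial_sum F k + F k.
Proof.
rewrite /partial_sum (bigD1 k)//= addrC; congr (_ + _).
by apply: eq_bigl => i; rewrite ltnS andbC [RHS]ltn_neqAle.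
Qed.

Lemma partial_sum_le F m n : (forall i, 0 <= F i) -> (m <= n)%N ->
  partial_sum F m <= partial_sum F n.
Proof.
move=> F0 mn; rewrite /partial_sum [leRHS](bigID (fun i : 'I_N => (i < m)%N))/=.
rewrite [X in _ <= X + _](eq_bigl (fun i : 'I_N => (i < m)%N)) ?lerDl
  ?sumr_ge0//.
move=> i.
by rewrite andb_idl// => im; exact: leq_trans im mn.
Qed.

Lemma partial_sumD F G m :
  partial_sum (fun i => F i + G i) m = partial_sum F m + partial_sum G m.
Proof. exact: big_split. Qed.

Lemma take_enum_ord m : (m <= N)%N ->
  take m (enum 'I_N) = [seq i : 'I_N <- enum 'I_N | (i < m)%N].
Proof.
move=> mN; apply: (inj_map val_inj); rewrite map_take val_enum_ord.
transitivity [seq j <- [seq val i | i <- enum 'I_N] | (j < m)%N].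
  by rewrite val_enum_ord take_iota (minn_idPl mN) (@filter_iota_ltn 0).
by rewrite filter_map.
Qed.

End PartialSums.

(** * Cumulated weights of correct and incorrect predictions *)

Section Curves.
Context {R : realType} {g : R -> R} {sstar : R} {N : nat}.
Context {d : 'I_N -> triple R} { pi : {perm 'I_N}}.
Context (weight_gt0 : forall i, 0 < weight (d i))
  (score_neq : forall i, score (d i) <> sstar).

Notation W := (total_weight d).
Notation w := (fun k => weight (d (pi k))).
Notation ok := (fun k => correct sstar (d (pi k))).
Notation rate := (rate g sstar d pi).

(** For [b] true and false these are the weights C_m and F_m of the overview. *)
Definition hits b (m : nat) : R :=
  partial_sum (fun k => w k * (ok k == b)%:R) m.

Lemma total_weight_gt0 : (0 < N)%N -> 0 < W.
Proof.
move=> N0; rewrite /total_weight (bigD1 (Ordinal N0))//=.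
by rewrite ltr_wpDr// sumr_ge0// => i _; exact: ltW.
Qed.

Lemma partial_weight m : partial_sum w m = hits true m + hits false m.
Proof.
rewrite -partial_sumD; apply: eq_bigr => k _.
by case: (correct _ _); rewrite /= mulr1 mulr0 ?addr0 ?add0r.
Qed.

Lemma hits0 b : hits b 0 = 0.
Proof. exact: partial_sum0. Qed.

Lemma hits_true_full : (0 < N)%N -> hits true N = accuracy sstar d * W.
Proof.
move=> N0; rewrite /accuracy divfK ?gt_eqF ?total_weight_gt0//.
rewrite /hits partial_sum_full [RHS](reindex_inj (@perm_inj _ pi)).
by apply: eq_bigr => k _; rewrite eqb_id.
Qed.

Lemma hits_total : hits true N + hits false N = W.
Proof.
rewrite -partial_weight partial_sum_full /total_weight.
by rewrite [RHS](reindex_inj (@perm_inj _ pi)).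
Qed.

(** * Rates along the ROC list *)

(** Above [sstar] the prediction is 1, so correct means label 1. Below it the prediction is 0, and
    the label negated by [dual] is 1 exactly when the prediction is correct. *)
Lemma label_upper k : label (upper g sstar d pi k) = ok k.
Proof.
rewrite /upper /dual /correct /predict.
case: ifP => [_|_]; first by case: label.
have /eqP/negbTE->/= := score_neq (pi k).
by case: label.
Qed.

Lemma weight_upper k : weight (upper g sstar d pi k) = w k.
Proof. by rewrite /upper /dual; case: ifP => _ //; case: ifP. Qed.

Lemma weight_lower k : weight (lower g sstar d pi k) = w k.
Proof. by rewrite /lower /dual; case: ifP => _ //; case: ifP. Qed.

(** Off [sstar], an item and its dual have opposite labels and equal weights, so each pair counts
    exactly once for either label. *)
Lemma weight_duplicated b :
  \sum_(x <- duplicated g sstar d | label x == b) weight x = W.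
Proof.
rewrite big_cat !big_map/= -enumT !big_enum_cond.
rewrite [X in X + _]big_mkcond [X in _ + X]big_mkcond/=.
rewrite -big_split/= /total_weight.
apply: eq_bigr => i _; rewrite /dual.
have /eqP/negbTE->/= := score_neq i.
by case: label; case: b; rewrite /= ?addr0 ?add0r.
Qed.

(** A prefix of length at most [N] holds upper triples only, whose labels record correctness. *)
Lemma rate_hits b m : (m <= N)%N -> rate b m = hits b m / W.
Proof.
move=> mN; rewrite /Defs.rate weight_duplicated; congr (_ / _).
rewrite /roc_list takel_cat; last by rewrite size_map size_enum_ord.
rewrite -map_take big_map.
have -> : @take 'I_N m (enum 'I_N) = [seq i : 'I_N <- enum 'I_N | (i < m)%N].
  exact: take_enum_ord.
rewrite big_filter_cond big_enum_cond.
rewrite /hits /partial_sum big_mkcond [RHS]big_mkcond; apply: eq_bigr => k _.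
rewrite label_upper weight_upper /=.
by case: ltnP; case: eqP; rewrite ?mulr1 ?mulr0.
Qed.

Lemma weight_roc_list_ge0 :
  all (fun x => 0 <= weight x) (roc_list g sstar d pi).
Proof.
rewrite all_cat all_rev !all_map; apply/andP; split; apply/allP => k _ /=.
  by rewrite weight_upper ltW.
by rewrite weight_lower ltW.
Qed.

(** This covers the lower half of the list too, which later excludes the segments of that half. *)
Lemma rate_le b m n : (m <= n)%N -> rate b m <= rate b n.
Proof.
move=> mn; rewrite /Defs.rate weight_duplicated ler_wpM2r//.
  by rewrite invr_ge0 sumr_ge0// => i _; exact: ltW.
rewrite -[in leRHS](subnKC mn) takeD big_cat/= lerDl.
move: weight_roc_list_ge0.
rewrite -{1}(cat_take_drop m (roc_list _ _ _ _)) all_cat => /andP[_].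
rewrite -{1}(cat_take_drop (n - m) (drop _ _)) all_cat => /andP[+ _].
elim: take => [|x s IH] /=; first by rewrite big_nil.
by case/andP=> x0 /IH s0; rewrite big_cons; case: ifP => // _; exact: addr_ge0.
Qed.

(** Strictly inside the k-th FPR step the curve is the k-th segment alone, and it is horizontal, so
    the supremum is over a single value. *)
Lemma roc_height_hits (k : 'I_N) x :
  rate false k < x < rate false k.+1 ->
  roc_height g sstar d pi x = hits true k / W.
Proof.
move=> /andP[kx xk]; rewrite /roc_height.
suff -> : [set y | roc_curve g sstar d pi (x, y)] = [set hits true k / W].
  exact: sup1.
(* FPR grows strictly at step k, so item k is incorrect and leaves TPR unchanged. *)
have Tk : rate true k.+1 = rate true k.
  move: kx xk => /lt_trans/[apply]; rewrite !rate_hits// 1?ltnW//.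
  rewrite /hits !partial_sumS.
  by case: (correct _ _); rewrite /= ?mulr0 ?addr0// ltxx.
have kN : (k <= N)%N by exact: ltnW.
apply/seteqP; split => y /=.
  (* The abscissa lies between the ends of segment [m]; by monotonicity, [m] other than [k] would
     put it outside the open step. *)
  move=> [m [a [mN /andP[a0 a1] /= xE yE]]].
  have Fm : rate false m <= rate false m.+1 by exact: rate_le.
  have mx : rate false m <= x.
    rewrite xE /FPR; nra.
  have xm : x <= rate false m.+1.
    rewrite xE /FPR; nra.
  have [mk|km|mk] := ltngtP m k.
  - have := le_lt_trans (le_trans xm (rate_le false _ _ mk)) kx.
    by rewrite ltxx.
  - have := lt_le_trans xk (le_trans (rate_le false _ _ km) mx).
    by rewrite ltxx.
  - by rewrite yE mk /TPR Tk rate_hits//; ring.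
move=> ->; have D : 0 < rate false k.+1 - rate false k.
  by rewrite subr_gt0; exact: lt_trans xk.
(* The parameter is the relative position of [x] along the k-th segment. *)
exists k, ((x - rate false k) / (rate false k.+1 - rate false k)); split.
- by rewrite (leq_trans (ltn_ord k))// leq_pmull.
- apply/andP; split; first by rewrite divr_ge0 ?(ltW D)// subr_ge0 ltW.
  by rewrite ler_pdivrMr// mul1r lerD2r ltW.
- by rewrite /FPR /=; field; exact: lt0r_neq0.
- by rewrite /TPR /= Tk (rate_hits true)//; ring.
Qed.

(** * The gain as a piecewise affine function *)

Lemma partial_weight_le m n : (m <= n)%N ->
  partial_sum w m <= partial_sum w n.
Proof. by move=> mn; apply: partial_sum_le => // i; exact: ltW. Qed.

(** The intervals cut out by the cumulated weights are disjoint, so whichever index [pick] returns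
    is [k]. *)
Lemma index_at_partial_sum (k : 'I_N) t :
  partial_sum w k < t <= partial_sum w k.+1 -> index_at d pi t = Some (pi k).
Proof.
move=> tk; rewrite /index_at; case: pickP => [l|/(_ k)]; last first.
  by move: tk; rewrite partial_sumS => ->.
have -> : weight_before d pi l + w l = partial_sum w l.+1.
  by rewrite partial_sumS.
move=> tl /=; congr (Some (pi _)); apply/val_inj/eqP; rewrite eqn_leq /=.
have le_index (i j : nat) :
    partial_sum w i < t -> t <= partial_sum w j.+1 -> (i <= j)%N.
  move=> it tj; rewrite leqNgt; apply/negP => /partial_weight_le.
  by rewrite leNgt (lt_le_trans it tj).
case/andP: tk tl => k1 k2 /andP[l1 l2].
by rewrite !le_index.
Qed.

Lemma correct_at_partial_sum (k : 'I_N) t :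
  partial_sum w k < t <= partial_sum w k.+1 ->
  correct_at sstar d pi t = ok k.
Proof. by rewrite /correct_at => /index_at_partial_sum ->. Qed.

Lemma integrates_correct_at m : (m <= N)%N ->
  integrates (fun r => (correct_at sstar d pi r)%:R) 0 (partial_sum w m)
    (hits true m).
Proof.
(* Bound and value are rewritten with their terms at index 0, so that the value telescopes over the
   steps. *)
move=> mN; rewrite -[hits true m]subr0 -[X in _ - X](hits0 true).
rewrite -(partial_sum0 w).
rewrite -telescope_sumr//; apply: integrates_sum => k km.
  exact: partial_weight_le.
pose i := Ordinal (leq_trans km mN).
have -> : hits true k.+1 - hits true k =
    (ok i)%:R * (partial_sum w k.+1 - partial_sum w k).
  rewrite /hits !(partial_sumS _ i) eqb_id; ring.
apply: integrates_constant => [|t /andP[kt tk]]; first exact: partial_weight_le.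
by rewrite (@correct_at_partial_sum i)// kt ltW.
Qed.

(** The integral is split at the k-th cumulated weight, past which the integrand is constant; the
    slope is 1/W or 0. *)
Lemma gain_partial_sum (k : 'I_N) t :
  partial_sum w k < t < partial_sum w k.+1 ->
  gain sstar d pi t = hits true k / W + (ok k)%:R / W * (t - partial_sum w k).
Proof.
move=> /andP[kt tk]; have kN : (k <= N)%N by exact: ltnW.
have P0 : 0 <= partial_sum w k by rewrite -(partial_sum0 w) partial_weight_le.
have kt_t : integrates (fun r => (correct_at sstar d pi r)%:R)
    (partial_sum w k) t ((ok k)%:R * (t - partial_sum w k)).
  apply: integrates_constant => [|r /andP[kr rt]]; first exact: ltW.
  by rewrite (@correct_at_partial_sum k)// kr (le_trans (ltW rt)) ?ltW.
have [_] :=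
  integrates_cat _ _ _ _ _ _ P0 (ltW kt) (integrates_correct_at _ kN) kt_t.
rewrite /gain => ->.
by ring.
Qed.

(** * The two areas as finite sums *)

Lemma LxCIM_hits : (0 < N)%N -> LxCIM sstar d pi = W ^- 2 *
  \sum_(0 <= k < N) (hits true k + hits true k.+1) *
     (partial_sum w k.+1 - partial_sum w k).
Proof.
move=> N0; have W0 : W != 0 by rewrite gt_eqF// total_weight_gt0.
rewrite /LxCIM; have := @integrates_sum _ (gain sstar d pi) (partial_sum w)
  (fun k => (2 * W)^-1 * ((hits true k + hits true k.+1) *
     (partial_sum w k.+1 - partial_sum w k))) N.
rewrite partial_sum0 partial_weight hits_total -mulr_sumr => -[||_ ->].
- by move=> k _; exact: partial_weight_le.
- move=> k kN; pose i := Ordinal kN.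
  (* Trapezoid rule: C_{k+1} - C_k is the correctness indicator times the width of the step. *)
  have -> : (2 * W)^-1 * ((hits true k + hits true k.+1) *
      (partial_sum w k.+1 - partial_sum w k)) =
      hits true k / W * (partial_sum w k.+1 - partial_sum w k) +
      (ok i)%:R / W * (partial_sum w k.+1 - partial_sum w k) ^+ 2 / 2.
    rewrite /hits !(partial_sumS _ i) eqb_id.
    by field.
  apply: integrates_affine; first exact: partial_weight_le.
  exact: (gain_partial_sum i).
by field.
Qed.

(** An incorrect item gives a rectangle of height C_k / W; a correct one gives an interval of zero
    width, where the condition on the height is vacuous. *)
Lemma partial_auc_hits : (0 < N)%N ->
  partial_auc g sstar d pi (hits false N / W) = W ^- 2 *
  \sum_(0 <= k < N) hits true k * (hits false k.+1 - hits false k).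
Proof.
move=> N0; have W0 : W != 0 by rewrite gt_eqF// total_weight_gt0.
rewrite /partial_auc; have := @integrates_sum _ (roc_height g sstar d pi)
  (fun k => hits false k / W)
  (fun k => W ^- 2 * (hits true k * (hits false k.+1 - hits false k))) N.
rewrite hits0 mul0r -mulr_sumr => -[||fi <-].
- by move=> k kN; rewrite -!rate_hits ?rate_le// ltnW.
- move=> k kN; pose i := Ordinal kN.
  have -> : W ^- 2 * (hits true k * (hits false k.+1 - hits false k)) =
     hits true k / W * (hits false k.+1 / W - hits false k / W) by field.
  rewrite -!(rate_hits false) ?(ltnW kN)//.
  by apply: integrates_constant; [exact: rate_le|exact: (@roc_height_hits i)].
by rewrite Rintegral_itv_obnd_cbnd.
Qed.

End Curves.

(** * Comparison of the two sums *)

Theorem proposition4 (R : realType) (g : R -> R) (sstar : R)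
    (hg : decision_function g sstar)
    (N : nat) (hN : (1 <= N)%N)
    (d : 'I_N -> triple R)
    (hw : forall i, 0 < weight (d i))
    (hs : forall i, score (d i) <> sstar)
    (pi : {perm 'I_N}) (hpi : sorting g d pi) :
  LxCIM sstar d pi =
    accuracy sstar d ^+ 2
    + 2 * partial_auc g sstar d pi (1 - accuracy sstar d).
Proof.
have W0 : total_weight d != 0 by rewrite gt_eqF// total_weight_gt0.
have accE : accuracy sstar d = @hits _ sstar _ d pi true N / total_weight d.
  by rewrite hits_true_full// mulfK.
(* The cut-off abscissa is FPR_N, reached at the middle of the ROC list. *)
have -> : 1 - accuracy sstar d = @hits _ sstar _ d pi false N / total_weight d.
  by rewrite accE -(@hits_total _ sstar _ d pi) in W0 *; field.
rewrite LxCIM_hits// partial_auc_hits// accE.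
set C := hits true in accE *; set F := hits false.
suff -> : \sum_(0 <= k < N) (C k + C k.+1) *
    (partial_sum (fun i => weight (d (pi i))) k.+1 -
     partial_sum (fun i => weight (d (pi i))) k) =
    C N ^+ 2 + 2 * \sum_(0 <= k < N) C k * (F k.+1 - F k) by field.
have -> : C N ^+ 2 = \sum_(0 <= k < N) (C k.+1 ^+ 2 - C k ^+ 2).
  by rewrite telescope_sumr// /C hits0 expr0n subr0.
rewrite mulr_sumr -big_split/= !big_mkord; apply: eq_bigr => k _.
have : (C k.+1 - C k) * (F k.+1 - F k) = 0.
  rewrite /C /F /hits !partial_sumS.
  by case: (correct _ _); rewrite /=; ring.
rewrite !(@partial_weight _ sstar) -/C -/F => CF.
(* The two sides differ by exactly the vanishing product of increments, added here on the right. *)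
by rewrite -[RHS]addr0 -CF; ring.
Qed.
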